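(* Let $p>2$ and $q$ be distinct primes, let $G$ be a group of order $p^2q$, and let $\gamma:G\to\operatorname{Aut}(G)$ be a gamma function on $G$. Then there exist a Sylow $p$-subgroup $P$ of $G$ which is invariant (that is, $P^{\gamma(x)}=P$ for all $x\in P$) and a Sylow $q$-subgroup $Q$ of $G$ which is invariant (that is, $Q^{\gamma(x)}=Q$ for all $x\in Q$).
   Context: Automorphisms act on the right, written as exponents ($x^{\alpha}$), and are composed from left to right. A gamma function (GF) on a group $G$ is a map $\gamma:G\to\operatorname{Aut}(G)$ satisfying $\gamma(g^{\gamma(h)}h)=\gamma(g)\gamma(h)$ for all $g,h\in G$. A subgroup $H\le G$ is called invariant if it is invariant under the action of $\gamma(H)=\{\gamma(x):x\in H\}$. *)

(* Defs.v *)
From mathcomp Require Import all_boot all_fingroup all_solvable.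

Set Implicit Arguments.
Unset Strict Implicit.
Unset Printing Implicit Defensive.

Local Open Scope group_scope.

(* [x ^ alpha] is the function application [alpha x]: permutations compose    *)
(* from left to right, [(s * t) x = t (s x)], so [Aut G] acts on the right.   *)
(* Only the restriction of [gamma] to [G] is constrained.                     *)
Definition gamma_function (gT : finGroupType) (G : {group gT})
    (gamma : gT -> {perm gT}) : Prop :=
  {in G, forall g, gamma g \in Aut G} /\
  {in G &, forall g h, gamma (gamma h g * h) = gamma g * gamma h}.

Definition invariant_subgroup (gT : finGroupType) (gamma : gT -> {perm gT})
    (H : {group gT}) : Prop :=
  {in H, forall x, gamma x @: H = H}.

(* Main.v *)
Require Import Defs.
From mathcomp Require Import all_boot all_fingroup all_solvable.

Set Implicit Arguments.
Unset Strict Implicit.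
Unset Printing Implicit Defensive.

Local Open Scope group_scope.

(* Let p be any prime divisor of |G|.                                         *)
(* Put x o h = gamma h x * h; the maps x |-> x o h form a regular group of    *)
(* permutations of G. Let S be a Sylow p-subgroup of it. Through gamma, S     *)
(* permutes the Sylow p-subgroups of G, whose number is 1 mod p, so it fixes  *)
(* some P; then S permutes the right cosets of P, whose number is prime to p, *)
(* so it fixes some Pg, and Pg is the S-orbit of g since both have the same   *)
(* order. The inverse image H of P under gamma g is then invariant: if x is   *)
(* in H then x o g lies in Pg, so x o g = g o h with h representing an        *)
(* element of S, and gamma x = gamma g gamma h (gamma g)^-1 stabilises H.     *)

(** The regular group of this outline is [circ_group], and [circ_gamma] is the homomorphism from it
    through which S acts on the Sylow subgroups. Both fixed points come from [pgroup_fixpoint];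
    [circ_perm_rcoset] supplies the action on cosets. The argument treats one prime at a time, so
    the theorem is [exists_invariant_Sylow] used for p and for q. *)

Lemma Aut_pSylow (gT : finGroupType) (G P : {group gT}) (p : nat)
    (a : {perm gT}) :
  a \in Aut G -> p.-Sylow(G) P ->
  exists2 H : {group gT}, p.-Sylow(G) H & H = a @: P :> {set gT}.
Proof.
move=> Aa sylP; have sPG := pHall_sub sylP.
exists (autm_morphism Aa @* P)%G; last by rewrite /= morphimEsub.
by rewrite -{1}(im_autm Aa) injm_pHall ?injm_autm.
Qed.

Lemma pgroup_fixpoint (aT : finGroupType) (sT : finType) (D : {group aT})
    (to : action D sT) (K : {group aT}) (S : {set sT}) (p : nat) :
  p.-group K -> [acts K, on S | to] -> ~~ (p %| #|S|)%N ->
  exists2 x, x \in S & {in K, forall a, to x a = x}.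
Proof.
move=> pK actK; rewrite /dvdn (pgroup_fix_mod pK actK) => nz.
have [x] : exists x, x \in 'Fix_(S | to)(K).
  by apply/set0Pn; apply: contraNneq nz => ->; rewrite cards0 mod0n.
by case/setIP=> Sx /afixP fixx; exists x.
Qed.

Section Gamma.

Variables (gT : finGroupType) (G : {group gT}) (gamma : gT -> {perm gT}).
Hypothesis gammaG : gamma_function G gamma.

Let gammaA g : g \in G -> gamma g \in Aut G.
Proof. by case: gammaG => A _ /A. Qed.

Let gammaM : {in G &, forall g h, gamma (gamma h g * h) = gamma g * gamma h}.
Proof. by case: gammaG. Qed.

Lemma gamma_closed g x : g \in G -> x \in G -> gamma g x \in G.
Proof. by move=> Gg; apply/Aut_closed/gammaA. Qed.

Lemma gamma_morphM g x y :
  g \in G -> x \in G -> y \in G -> gamma g (x * y) = gamma g x * gamma g y.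
Proof. by move=> Gg; apply: (morphicP (Aut_morphic (gammaA Gg))). Qed.

Lemma gamma_id1 g : g \in G -> gamma g 1 = 1.
Proof. by move=> Gg; rewrite -(autmE (gammaA Gg)) morph1. Qed.

Lemma gamma1 : gamma 1 = 1.
Proof.
have := gammaM (group1 G) (group1 G); rewrite gamma_id1 // mulg1.
by move/(canLR (mulKg _)); rewrite mulVg.
Qed.

(* Restricting to G is needed for circ_permM: off G, [gamma h] is the         *)
(* identity, and [x * g * h] need not equal [x * (gamma h g * h)].            *)
Definition circ_perm h := restr_perm G (gamma h * actperm 'R h).

Lemma circ_permE h x : h \in G -> x \in G -> circ_perm h x = gamma h x * h.
Proof.
move=> Gh Gx; rewrite restr_permE //; first by rewrite permM actpermE.
apply/astabsP=> y /=; rewrite apermE permM actpermE /= groupMr //.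
by have /setIdP[onG _] := gammaA Gh; apply: perm_closed.
Qed.

Lemma circ_perm1 h : h \in G -> circ_perm h 1 = h.
Proof. by move=> Gh; rewrite circ_permE // gamma_id1 ?mul1g. Qed.

(** The gamma function identity makes x o h associative on G, so these permutations are closed under
    composition. *)
Lemma circ_permM g h : g \in G -> h \in G ->
  circ_perm g * circ_perm h = circ_perm (gamma h g * h).
Proof.
move=> Gg Gh; have Ggh : gamma h g * h \in G by rewrite groupM ?gamma_closed.
apply/permP=> x; rewrite permM; have [Gx | nGx] := boolP (x \in G).
  rewrite !circ_permE ?groupM ?gamma_closed // gamma_morphM ?gamma_closed //.
  by rewrite gammaM // permM mulgA.
by rewrite !(out_perm (restr_perm_on _ _)).
Qed.

(** Since [gamma h] is multiplicative, (y x) o h is [gamma h y] times x o h. Hence right cosets of P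
    are permuted as soon as [gamma h] stabilises P. *)
Lemma circ_perm_rcoset (P : {group gT}) h x :
  P \subset G -> h \in G -> x \in G ->
  circ_perm h @: (P :* x) = (gamma h @: P) :* circ_perm h x.
Proof.
move=> sPG Gh Gx; apply/setP=> z; rewrite mem_rcoset; apply/imsetP/imsetP.
  case=> _ /rcosetP[y Py ->] ->; have Gy := subsetP sPG y Py.
  exists y => //; rewrite !circ_permE ?groupM // gamma_morphM //.
  by rewrite -(mulgA (gamma h y)) mulgK.
case=> y Py /(canRL (mulgKV _)) ->; have Gy := subsetP sPG y Py.
exists (y * x); first by rewrite mem_rcoset mulgK.
by rewrite !circ_permE ?groupM // gamma_morphM // mulgA.
Qed.

Definition circ_set := circ_perm @: G.

Lemma circ_group_set : group_set circ_set.
Proof.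
apply/group_setP; split.
  apply/imsetP; exists 1 => //; apply/permP=> x; rewrite perm1.
  have [Gx | nGx] := boolP (x \in G).
    by rewrite circ_permE // gamma1 perm1 mulg1.
  by rewrite (out_perm (restr_perm_on _ _)).
move=> _ _ /imsetP[g Gg ->] /imsetP[h Gh ->]; rewrite circ_permM //.
by apply: imset_f; rewrite groupM ?gamma_closed.
Qed.

Canonical circ_group := Group circ_group_set.

Lemma card_circ_group : #|circ_group| = #|G|.
Proof.
apply: card_in_imset => g h Gg Gh eq_gh.
by rewrite -(circ_perm1 Gg) eq_gh circ_perm1.
Qed.

(** Evaluation at 1 recovers h from [circ_perm h], because 1 o h = h. *)
Definition circ_gamma (s : {perm gT}) := gamma (s 1).

Lemma circ_gammaM : {in circ_group &, {morph circ_gamma : s t / s * t}}.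
Proof.
move=> _ _ /imsetP[g Gg ->] /imsetP[h Gh ->]; rewrite circ_permM //.
by rewrite /circ_gamma !circ_perm1 ?gammaM // groupM ?gamma_closed.
Qed.

Canonical circ_gamma_morphism := Morphism circ_gammaM.

Lemma exists_invariant_Sylow p :
  prime p ->
  exists P : {group gT}, P \in 'Syl_p(G) /\ invariant_subgroup gamma P.
Proof.
move=> p_pr; have [S sylS] := Sylow_exists p circ_group.
have sSC := pHall_sub sylS; have pS := pHall_pgroup sylS.
have oS : #|S| = (#|G|`_p)%N by rewrite (card_Hall sylS) card_circ_group.
have rep s : s \in S -> exists2 h, h \in G & s = circ_perm h.
  by move/(subsetP sSC)/imsetP.
have [P sylP fixP] : exists2 P : {group gT}, p.-Sylow(G) P &
    {in G, forall h, circ_perm h \in S -> gamma h @: P = P}.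
  (* Sylow subgroups are taken as bare sets, the points on which ['P^*] acts. *)
  have actS : [acts circ_gamma @* S, on [set gval P | P in 'Syl_p(G)] | 'P^*].
    apply/subsetP=> _ /morphimP[s _ Ss ->]; rewrite !inE /=.
    have [h Gh ->] := rep s Ss; rewrite /circ_gamma circ_perm1 //.
    apply/subsetP=> _ /imsetP[P sylP ->]; rewrite !inE in sylP *.
    have [H sylH defH] := Aut_pSylow (gammaA Gh) sylP.
    by apply/imsetP; exists H; rewrite ?inE.
  have [|_ /imsetP[P sylP ->] fixP] := pgroup_fixpoint (morphim_pgroup _ pS) actS.
    rewrite card_imset; last exact: val_inj.
    by rewrite /dvdn card_Syl_mod.
  exists P => [|h Gh Sh]; first by rewrite inE in sylP.
  have := fixP _ (mem_morphim circ_gamma_morphism (subsetP sSC _ Sh) Sh).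
  by rewrite /= /circ_gamma circ_perm1.
have sPG := pHall_sub sylP.
have [g Gg fixPg] : exists2 g, g \in G &
    {in S, forall s : {perm gT}, s @: (P :* g) = P :* g}.
  have actS : [acts S, on rcosets P G | 'P^*].
    apply/subsetP=> s Ss; rewrite !inE /=; apply/subsetP=> _ /rcosetsP[x Gx ->].
    have [h Gh defs] := rep s Ss; rewrite inE /= defs.
    rewrite [setact _ _ _]circ_perm_rcoset // fixP -?defs //.
    apply/rcosetsP; exists (s x); rewrite // defs.
    by rewrite circ_permE ?groupM ?gamma_closed.
  have [|_ /rcosetsP[g Gg ->] fixg] := pgroup_fixpoint pS actS.
    by have /and3P[_ _] := sylP; rewrite p'natE.
  by exists g.
have orbE : [set s g | s : {perm gT} in S] = P :* g.
  apply/eqP; rewrite eqEcard card_rcoset (card_Hall sylP) -oS; apply/andP; split.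
    apply/subsetP=> _ /imsetP[s Ss ->]; rewrite -(fixPg s Ss).
    by rewrite imset_f // rcoset_refl.
  rewrite card_in_imset // => s t Ss St.
  have [[h Gh ->] [k Gk ->]] := (rep s Ss, rep t St).
  (* Regularity: if g o h = g o k, then [circ_perm g] times s and times t coincide, and
     [circ_perm g] cancels. *)
  rewrite !circ_permE // => eq_g; apply: (mulgI (circ_perm g)).
  by rewrite !circ_permM ?eq_g.
have [|H sylH defH] := @Aut_pSylow _ G P p (gamma g)^-1 _ sylP.
  by rewrite groupV gammaA.
exists H; rewrite inE; split=> // x Hx.
have Gx := subsetP (pHall_sub sylH) x Hx.
have: gamma g x * g \in P :* g.
  rewrite mem_rcoset mulgK; move: Hx; rewrite defH => /imsetP[y Py ->].
  by rewrite permKV.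
rewrite -orbE => /imsetP[s Ss]; have [h Gh defs] := rep s Ss.
rewrite defs circ_permE // => eq_xg.
have /(canRL (mulgK _)) -> : gamma x * gamma g = gamma g * gamma h.
  by rewrite -!gammaM // eq_xg.
(* As H is the image of P under the inverse of [gamma g], the leading [gamma g] in the formula for
   [gamma x] cancels, and the remaining [gamma h] fixes P. *)
rewrite defH -imset_comp.
rewrite (eq_imset (g := (gamma g)^-1 \o gamma h)); last first.
  by move=> y /=; rewrite !permM permKV.
by rewrite imset_comp fixP // -defs.
Qed.

End Gamma.

Theorem proposition1p3 (gT : finGroupType) (G : {group gT}) (p q : nat)
    (gamma : gT -> {perm gT})
    (p_prime : prime p) (q_prime : prime q) (p_gt2 : (2 < p)%N)
    (p_neq_q : p <> q) (oG : #|G| = (p ^ 2 * q)%N)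
    (gammaG : gamma_function G gamma) :
  (exists P : {group gT}, P \in 'Syl_p(G) /\ invariant_subgroup gamma P) /\
  (exists Q : {group gT}, Q \in 'Syl_q(G) /\ invariant_subgroup gamma Q).
Proof. by split; apply: exists_invariant_Sylow. Qed.
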